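(* Let $U$ be a finite set, $n\ge1$ an integer, $\mu$ a distribution on $\binom{U}{n}$, and fix $i\in U$ with $\Pr_{S\sim\mu}[i\in S]>0$. Let $P_\mu$ (resp. $P_{\mu\mid i}$) be the transition kernel of an irreducible Markov chain on $\operatorname{supp}(\mu)$ (resp. $\operatorname{supp}(\mu\mid i)$) reversible w.r.t. $\mu$ (resp. $\mu\mid i$). Suppose $P_\mu$ is $\ell$-local and admits a $C$-amortized convergent coupling, both w.r.t. the Hamming metric $d_H(S,T)=|S\triangle T|$. Then $$\sum_{j\in U}\Big|\Pr_{S\sim\mu}[j\in S]-\Pr_{S\sim\mu\mid i}[j\in S]\Big| \le C\cdot\ell\cdot\max_{S\in\operatorname{supp}(\mu\mid i)}\Big\{\sum_{T\neq S}\big|P_\mu(S\to T)-P_{\mu\mid i}(S\to T)\big|\Big\}.$$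
   Context: $\mu\mid i$ denotes $\mu$ conditioned on the event $i\in S$, a distribution on $\binom{U}{n}$ with $\operatorname{supp}(\mu\mid i)\subseteq\operatorname{supp}(\mu)$; $P_{\mu\mid i}(S\to T)=0$ for $T\notin\operatorname{supp}(\mu\mid i)$. A chain $P$ on metric space $(\Omega,d)$ is $\ell$-local if $d(x,y)\le\ell$ whenever $P(x,y)>0$. For an irreducible $P$ reversible w.r.t. $\pi$ on finite $\Omega$ with metric $d$, a coupling $(X^{(t)},Y^{(t)})_{t\ge0}$ of two faithful copies of the chain is $C$-amortized convergent if for all $x,y$, $\sum_{t=0}^\infty\mathbb{E}[d(X^{(t)},Y^{(t)})\mid X^{(0)}=x,Y^{(0)}=y]\le C\,d(x,y)$. *)

(* Defs.v *)
From mathcomp Require Import all_boot all_order all_algebra.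
From mathcomp Require Import all_classical all_reals all_analysis.

Set Implicit Arguments.
Unset Strict Implicit.
Unset Printing Implicit Defensive.

Import Order.TTheory GRing.Theory Num.Theory.

Local Open Scope ring_scope.

Section Distributions.
Context {R : realType} {V : finType}.

(* Distributions on V are represented by their mass functions. *)
Definition is_distr (mu : V -> R) : Prop :=
  (forall x, 0 <= mu x) /\ \sum_x mu x = 1.

Definition supp (mu : V -> R) : {set V} := finset (fun x => 0 < mu x).

Definition Pr (mu : V -> R) (E : pred V) : R := \sum_(x | E x) mu x.

(* Meaningful only when 0 < Pr mu E. *)
Definition conditioned (mu : V -> R) (E : pred V) : V -> R :=
  fun x => if E x then mu x / Pr mu E else 0.

End Distributions.

Section Chains.
Context {R : realType} {V : finType}.

(* A chain on the state space Om is given by a kernel on the ambient type V.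
   Rows indexed by states of Om vanish outside Om; the other rows are
   unconstrained. *)
Definition is_kernel_on (Om : {set V}) (P : V -> V -> R) : Prop :=
  forall x, x \in Om ->
    [/\ forall y, 0 <= P x y,
        forall y, y \notin Om -> P x y = 0
      & \sum_y P x y = 1].

Fixpoint kernel_pow (P : V -> V -> R) (t : nat) (x y : V) : R :=
  if t is t'.+1 then \sum_z P x z * kernel_pow P t' z y else (x == y)%:R.

Definition irreducible_on (Om : {set V}) (P : V -> V -> R) : Prop :=
  forall x y, x \in Om -> y \in Om -> exists t, 0 < kernel_pow P t x y.

Definition reversible_on (Om : {set V}) (pi : V -> R) (P : V -> V -> R) : Prop :=
  forall x y, x \in Om -> y \in Om -> pi x * P x y = pi y * P y x.

Definition local_on (Om : {set V}) (d : V -> V -> R) (l : R)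
    (P : V -> V -> R) : Prop :=
  forall x y, x \in Om -> y \in Om -> 0 < P x y -> d x y <= l.

(* The Markov property is the usual one with the denominators cleared:
   Pr[Z_0 = s_0, ..., Z_(t+1) = s_(t+1)]
     = Pr[Z_0 = s_0, ..., Z_t = s_t] * P (s_t, s_(t+1)). *)
Definition markov_chain_from (disp : measure_display) (T : measurableType disp)
    (Q : probability T R) (P : V -> V -> R) (x : V) (Z : nat -> T -> V) : Prop :=
  Q [set w | Z 0%N w = x]%classic = 1%E /\
  forall (t : nat) (s : nat -> V),
    Q [set w | forall k, (k <= t.+1)%N -> Z k w = s k]%classic =
    (Q [set w | forall k, (k <= t)%N -> Z k w = s k]%classic
      * (P (s t) (s t.+1))%:E)%E.

(* A coupling of two faithful copies of the chain P on Om: cplX and cplY are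
   defined on a common space, and cpl_law x y is the joint law given
   (X_0, Y_0) = (x, y), under which each copy is by itself a Markov chain with
   kernel P. The pair need not be Markovian. *)
Record coupling (Om : {set V}) (P : V -> V -> R) := Coupling {
  cpl_disp : measure_display ;
  cpl_space : measurableType cpl_disp ;
  cpl_law : V -> V -> probability cpl_space R ;
  cplX : nat -> cpl_space -> V ;
  cplY : nat -> cpl_space -> V ;
  cplX_measurable : forall t z, measurable [set w | cplX t w = z]%classic ;
  cplY_measurable : forall t z, measurable [set w | cplY t w = z]%classic ;
  cplX_chain : forall x y, x \in Om -> y \in Om ->
    markov_chain_from (cpl_law x y) P x cplX ;
  cplY_chain : forall x y, x \in Om -> y \in Om ->
    markov_chain_from (cpl_law x y) P y cplY }.

Arguments cplX {Om P} K t w : rename.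
Arguments cplY {Om P} K t w : rename.
Arguments cpl_law {Om P} K x y : rename.

Definition amortized_convergent (Om : {set V}) (P : V -> V -> R)
    (d : V -> V -> R) (C : R) (K : coupling Om P) : Prop :=
  forall x y, x \in Om -> y \in Om ->
    (\sum_(0 <= t <oo) 'E_(cpl_law K x y)[(fun w => d (cplX K t w) (cplY K t w))]
      <= (C * d x y)%:E)%E.

End Chains.

Definition hamming (R : realType) (U : finType) (S T : {set U}) : R :=
  #|(S :\: T) :|: (T :\: S)|%:R.

Definition mem_event (U : finType) (j : U) : pred {set U} :=
  fun S => j \in S.

(* Main.v *)
(** Take [f S = \sum_j s_j [j \in S]] with [s_j] the sign of the [j]-th
    difference of marginals: [f] is 1-Lipschitz for the Hamming metric and the
    left-hand side is [mu f - nu f], where [nu = mu | i].  The partial sums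
    [h_N = \sum_(t < N) P^t f] solve the Poisson equation
    [h_N - P h_N = f - P^N f] approximately, and the coupling makes them
    [C]-Lipschitz.

    Since [P] is reversible for [nu] on [supp nu], only the steps of [P] leaving
    [supp nu] contribute to [nu (h_N - P h_N)].  On such steps [P_i] vanishes,
    so their mass is at most [\sum_T |P S T - P_i S T|], and their length is at
    most [l]; no locality of [P_i] is involved.

    Finally [mu f = mu (P^N f)], and [|mu (P^N f) - nu (P^N f)|] is the general
    term of a summable series, so summing over [N] and using the archimedean
    property removes this error term. *)
Require Import Defs.
From mathcomp Require Import all_boot all_order all_algebra.
From mathcomp Require Import all_classical all_reals all_analysis.
From mathcomp Require Import measurable_realfun.

Import Order.TTheory GRing.Theory Num.Theory.
Local Open Scope ring_scope.

(** * Random variables with finitely many values and the marginals of a Markov chain *)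

Lemma integral_finite_range (R : realType) (V : finType) (disp : measure_display)
    (T : measurableType disp) (Q : {measure set T -> \bar R}) (A : set T)
    (Z : T -> V) (g : V -> R) :
  measurable A -> (forall v, measurable [set w | Z w = v]%classic) ->
  (forall v, 0 <= g v) ->
  (\int[Q]_(w in A) (g (Z w))%:E =
     \sum_v (g v)%:E * Q ([set w | Z w = v] `&` A)%classic)%E.
Proof.
move=> mA mZ g0.
have gZ w : (g (Z w))%:E =
    (\sum_v (g v)%:E * (\1_([set w | Z w = v]%classic) w)%:E)%E.
  rewrite (bigD1 (Z w)) //= indicE mem_set // mule1 big1 ?adde0 // => v vZ.
  by rewrite indicE memNset ?mule0 //= => Zv; rewrite Zv eqxx in vZ.
have mI v : measurable_fun A (\1_([set w | Z w = v]%classic) : T -> R).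
  exact: measurable_indic.
under eq_integral do rewrite gZ.
rewrite ge0_integral_sum //=; first last.
- by move=> v w _; rewrite mule_ge0 ?lee_fin.
- by move=> v; apply: measurable_funeM; exact/measurable_EFinP.
apply: eq_bigr => v _.
rewrite ge0_integralZl_EFin //; last exact/measurable_EFinP.
by rewrite integral_indic.
Qed.

Lemma measure_finite_range (R : realType) (V : finType) (disp : measure_display)
    (T : measurableType disp) (Q : {measure set T -> \bar R}) (A : set T) (Z : T -> V) :
  measurable A -> (forall v, measurable [set w | Z w = v]%classic) ->
  (Q A = \sum_v Q ([set w | Z w = v] `&` A)%classic)%E.
Proof.
move=> mA mZ.
have := @integral_finite_range R V disp T Q A Z (fun=> 1) mA mZ (fun=> ler01).
by rewrite integral_cst // mul1e => ->; apply: eq_bigr => v _; rewrite mul1e.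
Qed.

(** The Markov property speaks only of whole trajectories from time 0; the law at time [t] comes
    from summing over the intermediate states, one step at a time. *)
Lemma markov_chain_marginal {R : realType} {V : finType} {disp : measure_display}
    {T : measurableType disp} {Q : probability T R} {P : V -> V -> R} {x : V}
    {Z : nat -> T -> V} :
  (forall t z, measurable [set w | Z t w = z]%classic) ->
  markov_chain_from Q P x Z ->
  forall t z, Q [set w | Z t w = z]%classic = (kernel_pow P t x z)%:E.
Proof.
move=> mZ [Q0 Qstep] t z.
pose path m (s : nat -> V) := [set w | forall k, (k <= m)%N -> Z k w = s k]%classic.
have mpath m s : measurable (path m s).
  rewrite (_ : path m s = \bigcap_(k in [set k | (k <= m)%N]) [set w | Z k w = s k])%classic.
    by apply: bigcap_measurableType => k _.
  by rewrite eqEsubset; split=> w /= H k; apply: H.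
(* The prefix [path m s] is arbitrary so that the induction can extend it by the value [u] of
   [Z m.+1]. *)
have Qpath t' : forall m s, (Q ([set w | Z (m + t')%N w = z] `&` path m s)%classic =
    Q (path m s) * (kernel_pow P t' (s m) z)%:E)%E.
  elim: t' => [|t' IH] m s.
    rewrite addn0 /=; have [szE|szN] := eqVneq.
      rewrite mule1; congr (Q _); rewrite eqEsubset; split=> w /=; first by case.
      by move=> H; split=> //; rewrite H.
    rewrite mule0 (_ : _ `&` _ = set0)%classic ?measure0 // -subset0 => w /= [Zz H].
    by move/eqP: szN; apply; rewrite -Zz H.
  rewrite (@measure_finite_range _ _ _ _ _ _ (Z m.+1)) //; last exact: measurableI.
  (* Only the values up to [m.+1] matter; the constant [u] beyond them is a filler. *)
  have pathS u : ([set w | Z m.+1 w = u] `&` path m s =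
      path m.+1 (fun k => if (k <= m)%N then s k else u))%classic.
    rewrite eqEsubset; split=> w /=.
      move=> [Zu H] k; rewrite leq_eqVlt => /predU1P[->|]; first by rewrite ltnn.
      by rewrite ltnS => km; rewrite km H.
    move=> H; split=> [|k km]; first by rewrite H // ltnn.
    by rewrite H ?km // ltnW.
  have Qfin : Q (path m s) \is a fin_num by exact: fin_num_measure.
  rewrite -(fineK Qfin) -EFinM /= mulr_sumr -sumEFin; apply: eq_bigr => u _.
  rewrite setICA pathS addnS -addSn IH {1}/path Qstep ltnn leqnn.
  rewrite (_ : [set w | _]%classic = path m s); last first.
    by rewrite eqEsubset; split=> w /= H k km; have := H k km; rewrite km.
  by rewrite -(fineK Qfin) -!EFinM mulrA.
have path0 : path 0%N (fun=> x) = [set w | Z 0%N w = x]%classic.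
  rewrite eqEsubset; split=> w /=; first exact.
  by move=> H k; rewrite leqn0 => /eqP->.
(* The start is almost surely [x], so intersecting with [Z 0 = x] loses no mass, and [Qpath] at
   [m = 0] gives the marginal. *)
have QD0 : Q ([set w | Z t w = z] `\` [set w | Z 0%N w = x])%classic = 0%E.
  apply/eqP; rewrite -measure_le0.
  have <- : Q (~` [set w | Z 0%N w = x])%classic = 0%E.
    by rewrite probability_setC // Q0 subee.
  by apply: le_measure; rewrite ?inE; [exact: measurableD|exact: measurableC|move=> w []].
have := Qpath t 0%N (fun=> x); rewrite path0 Q0 mul1e add0n => <-.
by rewrite -[RHS]add0e -QD0; exact: measureDI.
Qed.

(** * Action of a kernel on functions, and stationarity *)

Definition kernel_act {R : realType} {V : finType} (P : V -> V -> R) (t : nat)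
    (f : V -> R) (x : V) : R :=
  \sum_z kernel_pow P t x z * f z.

Lemma kernel_act0 (R : realType) (V : finType) (P : V -> V -> R) (f : V -> R) (x : V) :
  kernel_act P 0 f x = f x.
Proof.
rewrite /kernel_act (bigD1 x) //= eqxx mul1r big1 ?addr0 // => z zx.
by rewrite eq_sym (negPf zx) mul0r.
Qed.

Lemma kernel_actS (R : realType) (V : finType) (P : V -> V -> R) (t : nat)
    (f : V -> R) (x : V) :
  kernel_act P t.+1 f x = \sum_z P x z * kernel_act P t f z.
Proof.
rewrite /kernel_act /=; under eq_bigr do rewrite mulr_suml.
rewrite exchange_big; apply: eq_bigr => z _.
by rewrite mulr_sumr; apply: eq_bigr => y _; rewrite mulrA.
Qed.

Lemma notin_supp {R : realType} {V : finType} {mu : V -> R} {x : V} :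
  is_distr mu -> x \notin supp mu -> mu x = 0.
Proof.
move=> [mu0 _]; rewrite inE -leNgt => mux.
by apply/eqP; rewrite eq_le mux mu0.
Qed.

(** Detailed balance makes [mu] stationary: exchange the sums, turn [mu x * P x y] into
    [mu y * P y x], and use that row [y] has sum 1. Rows outside the support are unconstrained, but
    there [mu] vanishes. *)
Lemma reversible_sum {R : realType} {V : finType} {mu : V -> R} {P : V -> V -> R}
    (h : V -> R) :
  is_distr mu -> is_kernel_on (supp mu) P -> reversible_on (supp mu) mu P ->
  \sum_x mu x * (\sum_y P x y * h y) = \sum_x mu x * h x.
Proof.
move=> mu_distr Pker Prev.
under eq_bigr do rewrite mulr_sumr.
rewrite exchange_big; apply: eq_bigr => y _.
have [yS|yS] := boolP (y \in supp mu); last first.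
  rewrite (notin_supp mu_distr yS) mul0r big1 // => x _.
  have [xS|xS] := boolP (x \in supp mu).
    by have [_ -> //] := Pker x xS; rewrite mul0r mulr0.
  by rewrite (notin_supp mu_distr xS) mul0r.
have [_ Pout P1] := Pker y yS.
transitivity (\sum_x mu y * P y x * h y).
  apply: eq_bigr => x _; rewrite mulrA.
  have [xS|xS] := boolP (x \in supp mu); first by rewrite Prev.
  by rewrite (notin_supp mu_distr xS) (Pout x xS) mulr0 !mul0r.
by rewrite -mulr_suml -mulr_sumr P1 mulr1.
Qed.

Lemma reversible_kernel_act {R : realType} {V : finType} {mu : V -> R}
    {P : V -> V -> R} (t : nat) (f : V -> R) :
  is_distr mu -> is_kernel_on (supp mu) P -> reversible_on (supp mu) mu P ->
  \sum_x mu x * kernel_act P t f x = \sum_x mu x * f x.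
Proof.
move=> mu_distr Pker Prev; elim: t => [|t <-].
  by apply: eq_bigr => x _; rewrite kernel_act0.
by under eq_bigr do rewrite kernel_actS; exact: reversible_sum.
Qed.

(** * Conditioning on an event *)

Lemma supp_conditioned {R : realType} {V : finType} {mu : V -> R} {E : pred V} (x : V) :
  0 < Pr mu E -> (x \in supp (conditioned mu E)) = (x \in supp mu) && E x.
Proof.
move=> PrE; rewrite !inE /conditioned; case: (E x); rewrite ?ltxx ?andbF //.
by rewrite andbT pmulr_lgt0 // invr_gt0.
Qed.

Lemma conditioned_distr {R : realType} {V : finType} {mu : V -> R} {E : pred V} :
  is_distr mu -> 0 < Pr mu E -> is_distr (conditioned mu E).
Proof.
move=> [mu0 mu1] PrE; split=> [x|].
  by rewrite /conditioned; case: ifP => // _; rewrite divr_ge0 // ltW.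
rewrite -big_mkcond /= -mulr_suml -/(Pr mu E) divff //.
by rewrite gt_eqF.
Qed.

(* Reversibility makes the contributions of the pairs inside E cancel, so only
   the steps of P leaving E are seen by mu conditioned on E. *)
Lemma conditioned_generator_bound {R : realType} {V : finType} {mu : V -> R}
    {P : V -> V -> R} {E : pred V} (h : V -> R) (L K : R) :
  is_distr mu -> is_kernel_on (supp mu) P -> reversible_on (supp mu) mu P ->
  0 < Pr mu E ->
  (forall x y, x \in supp mu -> y \in supp mu -> E x -> ~~ E y -> 0 < P x y ->
    `|h x - h y| <= L) ->
  (forall x, x \in supp mu -> E x -> L * \sum_(y | ~~ E y) P x y <= K) ->
  `|\sum_x conditioned mu E x * (h x - \sum_y P x y * h y)| <= K.
Proof.
move=> mu_distr Pker Prev PrE hL LK.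
have nu_distr := conditioned_distr mu_distr PrE.
set nu := conditioned mu E in nu_distr *.
have nuE x : ~~ E x -> nu x = 0 by rewrite /nu /conditioned => /negPf->.
have nuS x : x \notin supp mu -> nu x = 0.
  by move=> xS; apply: notin_supp => //; rewrite supp_conditioned // (negPf xS).
(* On [E] the conditioned law is [mu] divided by a constant, so it inherits detailed balance; off
   the support both sides are 0. *)
have nurev x y : E x -> E y -> nu x * P x y = nu y * P y x.
  move=> Ex Ey; have [xS|xS] := boolP (x \in supp mu); last first.
    rewrite nuS // mul0r; have [yS|yS] := boolP (y \in supp mu).
      by have [_ -> //] := Pker y yS; rewrite mulr0.
    by rewrite nuS // mul0r.
  have [yS|yS] := boolP (y \in supp mu); last first.
    by have [_ -> //] := Pker x xS; rewrite mulr0 nuS // mul0r.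
  by rewrite /nu /conditioned Ex Ey mulrAC Prev // mulrAC.
have -> : \sum_x nu x * (h x - \sum_y P x y * h y) =
    \sum_x nu x * \sum_(y | ~~ E y) P x y * (h x - h y).
  (* By [nurev], swapping [x] and [y] turns the double sum into its opposite. *)
  have inE0 : \sum_(x | E x) \sum_(y | E y) nu x * P x y * (h x - h y) = 0.
    apply/eqP; rewrite -eqNr; apply/eqP; rewrite [RHS]exchange_big -sumrN /=.
    apply: eq_bigr => x Ex; rewrite -sumrN; apply: eq_bigr => y Ey.
    by rewrite nurev // -mulrN opprB.
  rewrite -[RHS]addr0 -[X in _ = _ + X]inE0 [X in _ = _ + X]big_mkcond -big_split; apply: eq_bigr => x _ /=.
  have [xS|xS] := boolP (x \in supp mu); last first.
    by rewrite nuS // !mul0r add0r; case: ifP => // _; rewrite big1 // => y _; rewrite !mul0r.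
  case: ifPn => Ex; last by rewrite nuE // !mul0r addr0.
  under [X in _ = _ + X]eq_bigr do rewrite -mulrA.
  rewrite -mulr_sumr -mulrDr; congr (_ * _).
  have [_ _ P1] := Pker x xS.
  rewrite -{1}[h x]mul1r -P1 mulr_suml -sumrB addrC (bigID E) /=.
  by congr (_ + _); apply: eq_bigr => y _; rewrite mulrBr.
apply: (le_trans (ler_norm_sum _ _ _)).
have -> : K = \sum_x nu x * K by case: nu_distr => _ nu1; rewrite -mulr_suml nu1 mul1r.
apply: ler_sum => x _; case: (nu_distr) => nu0 _.
have [/andP[xS Ex]|] := boolP ((x \in supp mu) && E x); last first.
  by case/nandP => H; rewrite ?(nuS _ H) ?(nuE _ H) !mul0r normr0.
rewrite normrM (ger0_norm (nu0 x)) ler_wpM2l //.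
apply: (le_trans _ (LK x xS Ex)); apply: (le_trans (ler_norm_sum _ _ _)).
rewrite mulr_sumr; apply: ler_sum => y Ey.
have [P0 Pout _] := Pker x xS.
have [->|Pxy] := eqVneq (P x y) 0; first by rewrite mul0r mulr0 normr0.
have [yS|/Pout Pxy0] := boolP (y \in supp mu); last by rewrite Pxy0 eqxx in Pxy.
by rewrite normrM ger0_norm // mulrC ler_wpM2r // hL // lt_neqAle eq_sym Pxy P0.
Qed.

(** * Comparison of the two means through the coupling *)

Lemma archimedean_le0 (R : realType) (a b : R) : (forall N, a *+ N <= b) -> a <= 0.
Proof.
move=> H; rewrite leNgt; apply/negP => a0.
have := H (Num.truncn (b / a)).+1.
by rewrite leNgt -mulr_natl -ltr_pdivrMr // truncnS_gt.
Qed.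

(** The joint law [p] of the pair at time [t] has the rows of the [t]-th power of [P] at [x] and [y]
    as marginals, so the difference is the [p]-average of [f u - f v]. *)
Lemma coupling_kernel_act {R : realType} {V : finType} {Om : {set V}}
    {P : V -> V -> R} (K : coupling Om P) (d : V -> V -> R) (f : V -> R) (t : nat)
    (x y : V) :
  (forall u v, 0 <= d u v) -> (forall u v, `|f u - f v| <= d u v) ->
  x \in Om -> y \in Om ->
  (`|kernel_act P t f x - kernel_act P t f y|%:E <=
    'E_(cpl_law K x y)[(fun w => d (cplX (c:=K) t w) (cplY (c:=K) t w))])%E.
Proof.
move=> d0 fd xO yO; set Q := cpl_law K x y.
have mX := @cplX_measurable _ _ _ _ K; have mY := @cplY_measurable _ _ _ _ K.
pose A u v := ([set w | cplX (c:=K) t w = u] `&` [set w | cplY (c:=K) t w = v])%classic.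
have mA u v : measurable (A u v) by exact: measurableI.
pose p u v := fine (Q (A u v)).
have QA u v : Q (A u v) = (p u v)%:E by rewrite fineK // fin_num_measure.
have p0 u v : 0 <= p u v by rewrite fine_ge0.
have pX u : kernel_pow P t x u = \sum_v p u v.
  apply: EFin_inj; rewrite -(markov_chain_marginal mX (cplX_chain K xO yO)) -/Q.
  rewrite (@measure_finite_range _ _ _ _ _ _ (cplY (c:=K) t)) // -sumEFin.
  by apply: eq_bigr => v _; rewrite setIC; exact: QA.
have pY v : kernel_pow P t y v = \sum_u p u v.
  apply: EFin_inj; rewrite -(markov_chain_marginal mY (cplY_chain K xO yO)) -/Q.
  rewrite (@measure_finite_range _ _ _ _ _ _ (cplX (c:=K) t)) // -sumEFin.
  by apply: eq_bigr => u _; exact: QA.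
have -> : 'E_Q[(fun w => d (cplX (c:=K) t w) (cplY (c:=K) t w))]%E =
    (\sum_u \sum_v d u v * p u v)%:E.
  rewrite unlock (@integral_finite_range _ _ _ _ Q setT
    (fun w => (cplX (c:=K) t w, cplY (c:=K) t w)) (fun uv => d uv.1 uv.2)) //; last first.
    move=> [u v]; rewrite (_ : [set w | _]%classic = A u v) //.
    by rewrite /A eqEsubset; split=> w /= [-> ->].
  rewrite pair_bigA -sumEFin; apply: eq_bigr => -[u v] _ /=.
  rewrite EFinM -QA setIT; congr (_ * Q _)%E.
  by rewrite /A eqEsubset; split=> w /= [-> ->].
have -> : kernel_act P t f x - kernel_act P t f y =
    \sum_u \sum_v p u v * (f u - f v).
  rewrite /kernel_act; under eq_bigr do rewrite pX mulr_suml.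
  under [X in _ - X]eq_bigr do rewrite pY mulr_suml.
  rewrite [X in _ - X]exchange_big -sumrB; apply: eq_bigr => u _.
  by rewrite -sumrB; apply: eq_bigr => v _; rewrite mulrBr.
rewrite lee_fin (le_trans (ler_norm_sum _ _ _)) // ler_sum // => u _.
rewrite (le_trans (ler_norm_sum _ _ _)) // ler_sum // => v _.
by rewrite normrM ger0_norm // mulrC ler_wpM2r.
Qed.

(** [L] bounds the change of every partial sum along a step leaving [E], and [B] the resulting
    drift. Keeping both abstract leaves all sign questions about [C] to the application. *)
Lemma amortized_conditioned_gap {R : realType} {V : finType} {mu : V -> R}
    {P : V -> V -> R} {E : pred V} {d : V -> V -> R} {C : R} (f : V -> R) (L B : R) :
  is_distr mu -> is_kernel_on (supp mu) P -> reversible_on (supp mu) mu P ->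
  0 < Pr mu E ->
  (exists K : coupling (supp mu) P, amortized_convergent d C K) ->
  (forall u v, 0 <= d u v) -> (forall u v, `|f u - f v| <= d u v) ->
  (forall x y, x \in supp mu -> y \in supp mu -> E x -> ~~ E y -> 0 < P x y ->
    C * d x y <= L) ->
  (forall x, x \in supp mu -> E x -> L * \sum_(y | ~~ E y) P x y <= B) ->
  `|\sum_x mu x * f x - \sum_x conditioned mu E x * f x| <= B.
Proof.
move=> mu_distr Pker Prev PrE [K Kconv] d0 fd dL LB.
have [nu0 nu1] := conditioned_distr mu_distr PrE.
have [mu0 mu1] := mu_distr.
set nu := conditioned mu E in nu0 nu1 *.
have nuS x : x \notin supp mu -> nu x = 0.
  move=> xS; apply: notin_supp; first exact: conditioned_distr.
  by rewrite supp_conditioned // (negPf xS).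
pose ED x y t := ('E_(cpl_law K x y)[(fun w => d (cplX (c:=K) t w) (cplY (c:=K) t w))])%E.
have ED0 x y t : (0 <= ED x y t)%E by apply: expectation_ge0.
have EDsum N x y : x \in supp mu -> y \in supp mu ->
    (\sum_(0 <= t < N) ED x y t <= (C * d x y)%:E)%E.
  move=> xS yS; apply: le_trans (Kconv x y xS yS).
  by apply: nneseries_lim_ge.
pose g t x y := `|kernel_act P t f x - kernel_act P t f y|.
have gsum N x y : x \in supp mu -> y \in supp mu ->
    \sum_(0 <= t < N) g t x y <= C * d x y.
  move=> xS yS; rewrite -lee_fin -sumEFin (le_trans _ (EDsum N x y xS yS)) //.
  by apply: lee_sum => t _; exact: coupling_kernel_act.
pose h N x := \sum_(0 <= t < N) kernel_act P t f x.
have hgen N x : h N x - \sum_y P x y * h N y = f x - kernel_act P N f x.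
  rewrite /h; under [X in _ - X]eq_bigr do rewrite mulr_sumr.
  rewrite [X in _ - X]exchange_big /=; under [X in _ - X]eq_bigr do rewrite -kernel_actS.
  rewrite -sumrB (telescope_sumr_eq (fun t => - kernel_act P t f x)) //.
    by rewrite opprK addrC kernel_act0.
  by move=> t _; rewrite opprK addrC.
(* Mean of [g t] when the two starting points are drawn independently from [mu] and [nu]. Its
   partial sums have a bound free of [N], and it dominates the error term at time [t]. *)
pose G t := \sum_x \sum_y mu x * nu y * g t x y.
have Gsum N : \sum_(0 <= t < N) G t <= \sum_x \sum_y mu x * nu y * (C * d x y).
  rewrite /G exchange_big ler_sum // => x _.
  rewrite exchange_big ler_sum // => y _ /=; rewrite -mulr_sumr.
  have [xS|xS] := boolP (x \in supp mu); last by rewrite (notin_supp mu_distr xS) !mul0r.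
  have [yS|yS] := boolP (y \in supp mu); last by rewrite (nuS _ yS) mulr0 !mul0r.
  by rewrite ler_wpM2l ?mulr_ge0 ?gsum.
have muG t : `|\sum_x mu x * f x - \sum_y nu y * kernel_act P t f y| <= G t.
  rewrite -(reversible_kernel_act t f mu_distr Pker Prev).
  have -> : \sum_x mu x * kernel_act P t f x - \sum_y nu y * kernel_act P t f y =
      \sum_x \sum_y mu x * nu y * (kernel_act P t f x - kernel_act P t f y).
    transitivity (\sum_x (mu x * kernel_act P t f x
        - mu x * \sum_y nu y * kernel_act P t f y)).
      by rewrite sumrB -mulr_suml mu1 mul1r.
    apply: eq_bigr => x _; rewrite -mulrBr -[kernel_act P t f x in LHS]mul1r -nu1.
    rewrite mulr_suml -sumrB mulr_sumr.
    by apply: eq_bigr => y _; rewrite -mulrBr mulrA.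
  rewrite (le_trans (ler_norm_sum _ _ _)) // ler_sum // => x _.
  rewrite (le_trans (ler_norm_sum _ _ _)) // ler_sum // => y _.
  by rewrite normrM ger0_norm ?mulr_ge0.
have nuB N : `|\sum_x nu x * f x - \sum_x nu x * kernel_act P N f x| <= B.
  rewrite -sumrB; under eq_bigr do rewrite -mulrBr -hgen.
  apply: (conditioned_generator_bound (h N) L B mu_distr Pker Prev PrE _ LB).
  move=> x y xS yS Ex Ey Pxy; apply: le_trans (dL _ _ xS yS Ex Ey Pxy).
  rewrite /h -sumrB (le_trans (ler_norm_sum _ _ _)) //; exact: gsum.
(* Each [t < N] gives gap minus [B] at most [G t]; hence [N] times this excess stays below the fixed
   bound of [Gsum]. *)
rewrite -subr_le0; apply: archimedean_le0 => N.
apply: le_trans (Gsum N).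
rewrite -[N in _ *+ N]subn0 -sumr_const_nat ler_sum // => t _.
rewrite lerBlDr.
apply: (le_trans (ler_distD (\sum_y nu y * kernel_act P t f y) _ _)).
by rewrite lerD // distrC.
Qed.

(** * The Hamming metric and the bound on marginals *)

Lemma hamming_ge0 (R : realType) {U : finType} (S T : {set U}) : 0 <= hamming R S T.
Proof. by rewrite ler0n. Qed.

Lemma hamming_gt0 (R : realType) {U : finType} {S T : {set U}} :
  S != T -> 0 < hamming R S T.
Proof.
move=> ST; rewrite ltr0n card_gt0; apply: contra_neq ST => /eqP.
by rewrite finset.setU_eq0 !finset.setD_eq0 -finset.eqEsubset => /eqP.
Qed.

(** As an l1 distance between indicator vectors, the metric can be compared coordinate by coordinate
    with a signed sum of indicators. *)
Lemma hammingE (R : realType) (U : finType) (S T : {set U}) :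
  hamming R S T = \sum_j `|(j \in S)%:R - (j \in T)%:R : R|.
Proof.
rewrite /hamming -sum1_card natr_sum big_mkcond; apply: eq_bigr => j _.
rewrite !inE; case: (j \in S); case: (j \in T) => /=;
  by rewrite ?subrr ?subr0 ?sub0r ?normrN ?normr0 ?normr1.
Qed.

Theorem theorem1p7 (R : realType) (U : finType) (n : nat) (hn : (1 <= n)%N)
    (mu : {set U} -> R) (mu_distr : is_distr mu)
    (mu_card : forall S : {set U}, S \in supp mu -> #|S| = n)
    (i : U) (hi : 0 < Pr mu (mem_event i))
    (P P_i : {set U} -> {set U} -> R)
    (P_kernel : is_kernel_on (supp mu) P)
    (P_irr : irreducible_on (supp mu) P)
    (P_rev : reversible_on (supp mu) mu P)
    (P_i_kernel : is_kernel_on (supp (conditioned mu (mem_event i))) P_i)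
    (P_i_irr : irreducible_on (supp (conditioned mu (mem_event i))) P_i)
    (P_i_rev : reversible_on (supp (conditioned mu (mem_event i))) (conditioned mu (mem_event i)) P_i)
    (l C : R)
    (P_local : local_on (supp mu) (@hamming R U) l P)
    (P_coupling : exists K : coupling (supp mu) P,
        amortized_convergent (@hamming R U) C K) :
  \sum_(j : U) `|Pr mu (mem_event j)
                 - Pr (conditioned mu (mem_event i)) (mem_event j)|
  <= C * l * \big[Num.max/0]_(S in supp (conditioned mu (mem_event i)))
               \sum_(T : {set U} | T != S) `|P S T - P_i S T|.
Proof.
set E := mem_event i; set nu := conditioned mu E.
set M := \big[Num.max/0]_(S in _) _.
pose sg (j : U) : R := Num.sg (Pr mu (mem_event j) - Pr nu (mem_event j)).
pose f (S : {set U}) : R := \sum_j sg j * (j \in S)%:R.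
have sumf (rho : {set U} -> R) :
    \sum_S rho S * f S = \sum_j sg j * Pr rho (mem_event j).
  under eq_bigr do rewrite mulr_sumr.
  rewrite exchange_big; apply: eq_bigr => j _.
  rewrite /Pr [in RHS]big_mkcond mulr_sumr; apply: eq_bigr => S _ /=.
  by rewrite mulrCA /mem_event; case: (j \in S); rewrite ?mulr1 ?mulr0.
have -> : \sum_j `|Pr mu (mem_event j) - Pr nu (mem_event j)| =
    \sum_S mu S * f S - \sum_S nu S * f S.
  by rewrite !sumf -sumrB; apply: eq_bigr => j _; rewrite -mulrBr -normrEsg.
apply: (le_trans (ler_norm _)).
have fd S T : `|f S - f T| <= hamming R S T.
  rewrite hammingE -sumrB (le_trans (ler_norm_sum _ _ _)) // ler_sum // => j _.
  by rewrite -mulrBr normrM ler_piMl // normr_sg; case: (_ != 0).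
(* A set [T] outside [E] is outside the support of [nu], so [P_i S T = 0]; it also differs from [S],
   which lies in [E], so its term occurs in the sum defining [M]. *)
have exitM S : S \in supp mu -> E S -> \sum_(T | ~~ E T) P S T <= M.
  move=> SS ES; have Snu : S \in supp nu by rewrite supp_conditioned ?SS.
  apply: (le_trans _ (le_bigmax_cond 0 _ Snu)).
  rewrite [leRHS](bigID E) /= ler_wpDl ?sumr_ge0 //.
  rewrite [leRHS](eq_bigl (fun T => ~~ E T)); last first.
    by move=> T; case: eqVneq => // ->; rewrite ES.
  apply: ler_sum => T ET; have [_ -> //] := P_i_kernel S Snu.
    by rewrite subr0 ler_norm.
  by rewrite supp_conditioned // negb_and ET orbT.
(* The sign of [C] is forced as soon as two distinct states exist: a nonnegative series is at most
   [C] times a positive distance. *)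
have C0 S T : S \in supp mu -> T \in supp mu -> S != T -> 0 <= C.
  move=> SS TS ST; have [K Kconv] := P_coupling.
  rewrite -(pmulr_lge0 _ (hamming_gt0 R ST)) -lee_fin (le_trans _ (Kconv S T SS TS)) //.
  by apply: nneseries_ge0 => t _ _; apply: expectation_ge0 => w; exact: hamming_ge0.
apply: (amortized_conditioned_gap f (C * l) _ mu_distr P_kernel P_rev hi P_coupling _ fd).
- by move=> S T; exact: hamming_ge0.
- move=> S T SS TS ES ET PST; rewrite ler_wpM2l ?P_local //.
  by apply: (C0 S T) => //; apply: contraNneq ET => <-.
(* If [S] is the only state, the signs of [C] and [l] are not determined, but the exit mass and [M]
   are both 0. *)
move=> S SS ES; have [/forall_inP Sonly|] := boolP [forall T in supp mu, T == S].
  have [_ Pout _] := P_kernel S SS.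
  rewrite big1 ?mulr0 => [|T ET]; last first.
    by apply: Pout; apply: contra ET => /Sonly/eqP->.
  rewrite /M big1_idem ?mulr0 //; first exact: maxxx.
  move=> S'; rewrite supp_conditioned // => /andP[/Sonly/eqP-> _].
  rewrite big1 // => T TS.
  have TO : T \notin supp mu by apply: contra TS; exact: Sonly.
  have Snu : S \in supp nu by rewrite supp_conditioned ?SS.
  have [_ -> //] := P_i_kernel S Snu; first by rewrite Pout // subrr normr0.
  by rewrite supp_conditioned // negb_and TO.
case/forall_inPn => T TS TneS.
have C_ge0 : 0 <= C by exact: (C0 T S).
(* Row [S] has sum 1, so some step has positive probability, and its nonnegative length is at most
   [l]. *)
have l_ge0 : 0 <= l.
  have [P0 Pout P1] := P_kernel S SS.
  have /existsP[T' PST'] : [exists T', P S T' != 0].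
    apply: contraTT (ltr01 : 0 < 1 :> R) => /existsPn H.
    by rewrite -P1 big1 ?ltxx // => T' _; apply/eqP; rewrite -[_ == _]negbK.
  apply: le_trans (hamming_ge0 R S T') (P_local S T' SS _ _).
    by apply: contraNT PST' => /Pout->.
  by rewrite lt_neqAle eq_sym PST' P0.
by rewrite ler_wpM2l ?mulr_ge0 ?exitM.
Qed.
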